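(* Let $\mathcal P$ be a GTDS instance with rational discount factor $\lambda$, rational weights $a_1,\dots,a_k$, and rational target $t$. If $\mathcal P$ has no solution, then the $<$-universality and $\le$-universality problems with threshold $t$ are decidable over the class of discounted-sum automata over finite words (resp. over infinite words) with discount factor $\lambda$ and all transition weights in $\{a_1,\dots,a_k\}$.
   Context: An instance of GTDS consists of a rational discount factor $0<\lambda<1$, a rational target $t$, and rational weights $a_1,\dots,a_k$; a solution is an infinite $w\in\{a_1,\dots,a_k\}^\omega$ with $\sum_{i=0}^\infty w(i)\lambda^i=t$. A discounted-sum automaton (DSA) is $\langle\Sigma,Q,q_{in},Q_F,\delta,\gamma,\lambda\rangle$ with finite alphabet, finite state set $Q$, initial state $q_{in}$, accepting states $Q_F$, transition relation $\delta\subseteq Q\times\Sigma\times Q$, weights $\gamma:\delta\to\mathbb Q$, discount factor $\lambda$. A run on a word $\sigma_1\sigma_2\cdots$ is $q_0,\sigma_1,q_1,\dots$ with $q_0=q_{in}$, $(q_i,\sigma_{i+1},q_{i+1})\in\delta$; a finite run is accepting if it ends in $Q_F$, and every infinite run is accepting; a run's value is $\sum_i\lambda^i\gamma(q_i,\sigma_{i+1},q_{i+1})$; $\mathcal A(w)$ is the infimum of values of accepting runs on $w$. The $<$-universality (resp. $\le$-universality) problem with threshold $t$ asks whether $\mathcal A(w)<t$ (resp. $\mathcal A(w)\le t$) for every word $w$ (finite words for finite-word automata, infinite words for infinite-word automata). *)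

(* Defs.v *)
From HB Require Import structures.
From mathcomp Require Import all_boot all_order all_algebra.
From mathcomp Require Import all_classical all_reals all_analysis.
Set Implicit Arguments. Unset Strict Implicit. Unset Printing Implicit Defensive.
Import Order.TTheory GRing.Theory Num.Theory.
Import numFieldNormedType.Exports.
Local Open Scope ring_scope.
Local Open Scope classical_set_scope.

Inductive recf : Type :=
| RZero : recf
| RSucc : recf
| RProj : nat -> recf
| RComp : recf -> seq recf -> recf
| RPrim : recf -> recf -> recf
| RMu   : recf -> recf.

Inductive evalr : recf -> seq nat -> nat -> Prop :=
| ev_zero v : evalr RZero v 0
| ev_succ x v : evalr RSucc (x :: v) x.+1
| ev_proj i v : (i < size v)%N -> evalr (RProj i) v (nth 0%N v i)
| ev_comp f gs v ys y :
    evalrs gs v ys -> evalr f ys y -> evalr (RComp f gs) v y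
| ev_prim0 f g v y : evalr f v y -> evalr (RPrim f g) (0%N :: v) y
| ev_primS f g n v z y :
    evalr (RPrim f g) (n :: v) z -> evalr g (n :: z :: v) y ->
    evalr (RPrim f g) (n.+1 :: v) y
| ev_mu f v n :
    evalr f (n :: v) 0 ->
    (forall k, (k < n)%N -> exists y, (0 < y)%N /\ evalr f (k :: v) y) ->
    evalr (RMu f) v n
with evalrs : seq recf -> seq nat -> seq nat -> Prop :=
| evs_nil v : evalrs [::] v [::]
| evs_cons g gs v y ys :
    evalr g v y -> evalrs gs v ys -> evalrs (g :: gs) v (y :: ys).

(* A problem P restricted to the class C (of objects of a countable type,
   encoded as natural numbers by the standard computable encoding
   [pickle]) is decidable if some mu-recursive program halts on the code
   of every member of C with output 1 or 0 answering whether P holds. *)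
Definition decidable_over (X : countType) (C : X -> Prop) (P : X -> Prop) :=
  exists p : recf, forall x, C x ->
    exists b : bool, evalr p [:: pickle x] (nat_of_bool b) /\ (b = true <-> P x).

Definition gtds_solution (R : realType) (lam t : rat) (a : seq rat)
  (w : nat -> rat) : Prop :=
  (forall i, w i \in a) /\
  limn (series (fun i => ratr (w i) * (ratr lam) ^+ i : R)) = ratr t.

Definition gtds_has_solution (R : realType) (lam t : rat) (a : seq rat) :=
  exists w, @gtds_solution R lam t a w.

(* Discounted-sum automata (discount factor fixed externally)         *)
Definition trans := (nat * nat * nat * rat)%type.
Definition tsrc (x : trans) : nat := x.1.1.1.
Definition tlet (x : trans) : nat := x.1.1.2.
Definition tdst (x : trans) : nat := x.1.2.
Definition twt (x : trans) : rat := x.2.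

(* (number of states n, alphabet size m, initial state, accepting states,
   weighted transition relation); states are 0..n-1, letters 0..m-1. *)
Definition dsa := (nat * nat * nat * seq nat * seq trans)%type.
Definition dsa_nst (A : dsa) : nat := A.1.1.1.1.
Definition dsa_nlet (A : dsa) : nat := A.1.1.1.2.
Definition dsa_init (A : dsa) : nat := A.1.1.2.
Definition dsa_acc (A : dsa) : seq nat := A.1.2.
Definition dsa_delta (A : dsa) : seq trans := A.2.

(* well-formed DSA all of whose weights lie in [a]; uniqueness of the
   triples (q,s,q') makes gamma a function on delta. *)
Definition dsa_in_class (a : seq rat) (A : dsa) : Prop :=
  [/\ (dsa_init A < dsa_nst A)%N,
      all (fun q => q < dsa_nst A)%N (dsa_acc A),
      all (fun x => [&& tsrc x < dsa_nst A, tlet x < dsa_nlet A,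
                        tdst x < dsa_nst A & twt x \in a])%N (dsa_delta A)
    & uniq (map (fun x => (tsrc x, tlet x, tdst x)) (dsa_delta A))].

Definition dtrans : trans := (0%N, 0%N, 0%N, 0).

(* finite words: sequences of letters < m (the empty word included) *)
Definition fin_word (A : dsa) (w : seq nat) : Prop :=
  all (fun s => s < dsa_nlet A)%N w.

Definition fstate (A : dsa) (trs : seq trans) (i : nat) : nat :=
  if i is j.+1 then tdst (nth dtrans trs j) else dsa_init A.

Definition fin_run (A : dsa) (w : seq nat) (trs : seq trans) : Prop :=
  size trs = size w /\
  forall i, (i < size trs)%N ->
    [/\ nth dtrans trs i \in dsa_delta A,
        tlet (nth dtrans trs i) = nth 0%N w i
      & tsrc (nth dtrans trs i) = fstate A trs i].

Definition fin_accepting (A : dsa) (trs : seq trans) : Prop :=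
  fstate A trs (size trs) \in dsa_acc A.

Definition fin_value (R : realType) (lam : rat) (trs : seq trans) : R :=
  \sum_(i < size trs) (ratr lam) ^+ i * ratr (twt (nth dtrans trs i)).

(* A(w) on finite words: infimum over accepting runs (+oo if none) *)
Definition fin_A (R : realType) (lam : rat) (A : dsa) (w : seq nat) : \bar R :=
  ereal_inf [set (fin_value R lam trs)%:E | trs in
               [set trs | fin_run A w trs /\ fin_accepting A trs]].

Definition inf_word (A : dsa) (w : nat -> nat) : Prop :=
  forall i, (w i < dsa_nlet A)%N.

Definition inf_run (A : dsa) (w : nat -> nat) (trs : nat -> trans) : Prop :=
  tsrc (trs 0%N) = dsa_init A /\
  forall i, [/\ trs i \in dsa_delta A, tlet (trs i) = w i
              & tdst (trs i) = tsrc (trs i.+1)].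

Definition inf_value (R : realType) (lam : rat) (trs : nat -> trans) : R :=
  limn (series (fun i => (ratr lam) ^+ i * ratr (twt (trs i)) : R)).

(* every infinite run is accepting *)
Definition inf_A (R : realType) (lam : rat) (A : dsa) (w : nat -> nat) : \bar R :=
  ereal_inf [set (inf_value R lam trs)%:E | trs in [set trs | inf_run A w trs]].

Definition fin_lt_universal (R : realType) (lam t : rat) (A : dsa) : Prop :=
  forall w, fin_word A w -> (fin_A R lam A w < (ratr t : R)%:E)%E.
Definition fin_le_universal (R : realType) (lam t : rat) (A : dsa) : Prop :=
  forall w, fin_word A w -> (fin_A R lam A w <= (ratr t : R)%:E)%E.
Definition inf_lt_universal (R : realType) (lam t : rat) (A : dsa) : Prop :=
  forall w, inf_word A w -> (inf_A R lam A w < (ratr t : R)%:E)%E.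
Definition inf_le_universal (R : realType) (lam t : rat) (A : dsa) : Prop :=
  forall w, inf_word A w -> (inf_A R lam A w <= (ratr t : R)%:E)%E.

(* Main.v *)
Require Import Defs.
From HB Require Import structures.
From mathcomp Require Import all_boot all_order all_algebra.
From mathcomp Require Import all_classical all_reals all_analysis.
From mathcomp Require Import zify ring lra.
Set Implicit Arguments. Unset Strict Implicit. Unset Printing Implicit Defensive.
Import Order.TTheory GRing.Theory Num.Theory.

(**
If the GTDS instance has no solution, then by compactness of the space of
infinite weight sequences the discounted sums stay at a positive distance from
[t], so for some [N] the first [N] weights of any run of length at least [N]
decide on which side of [t] its value lies.  Hence only finitely many weight
prefixes (hard-coded in the program as a table of codes, so that no rational
arithmetic is executed) count as low, and universality asks that every word
have an (accepting) run with a low prefix.  Beyond length [N] the set of states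
reached by low runs evolves as in the subset construction, so by pigeonhole a
counterexample of length more than [N + 2 ^ n] can be shortened, [n] being the
number of states; infinite words reduce to finite ones by Koenig's lemma.
Universality thus becomes a bounded quantification over codes of words and
runs, which is primitive recursive.
*)

(** * Mu-recursive functions *)

(** Only argument lists of length [k] are constrained. The list serves as a context of de Bruijn
    variables, read off with [head] and [behead]. *)
Definition computes (k : nat) (f : seq nat -> nat) :=
  exists p, forall v, size v = k -> evalr p v (f v).

Lemma eq_computes k f g :
  (forall v, size v = k -> f v = g v) -> computes k f -> computes k g.
Proof. by move=> fg [p pP]; exists p => v vk; rewrite -fg //; exact: pP. Qed.

Lemma evalrs_proj s v : all (fun i => i < size v) s ->
  evalrs (map RProj s) v (map (nth 0 v) s).
Proof.
elim: s => [|i s IHs] /= => [_|/andP[iv sv]]; first by constructor.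
by constructor; [constructor | exact: IHs].
Qed.

Lemma evalrs_proj_id v : evalrs (map RProj (iota 0 (size v))) v v.
Proof.
rewrite -[X in evalrs _ _ X](mkseq_nth 0) /mkseq.
by apply: evalrs_proj; apply/allP => i; rewrite mem_iota.
Qed.

Lemma computes_nth k i : i < k -> computes k (fun v => nth 0 v i).
Proof. by move=> ik; exists (RProj i) => v vk; constructor; rewrite vk. Qed.

Lemma computes_var0 k : computes k.+1 (fun v => head 0 v).
Proof.
apply: eq_computes (computes_nth (ltn0Sn k)) => v _.
by rewrite nth0.
Qed.

(** Weakening by one freshly bound variable: composing with the projections 1, ..., [k] drops the
    first argument. *)
Lemma computes_behead k f : computes k f -> computes k.+1 (fun v => f (behead v)).
Proof.
move=> [p pP]; exists (RComp p (map RProj (iota 1 k))) => -[//|x v] [vk].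
apply: (ev_comp (ys := v)); last exact: pP.
rewrite -[X in evalrs _ _ X](mkseq_nth 0) /mkseq vk.
rewrite (_ : map (nth 0 v) _ = map (nth 0 (x :: v)) (iota 1 k)); last first.
  by rewrite -[1]addn0 iotaDl -map_comp.
apply: evalrs_proj; apply/allP => i; rewrite mem_iota /= vk; lia.
Qed.

Lemma computes_var1 k : computes k.+2 (fun v => head 0 (behead v)).
Proof. exact/(computes_behead (f := head 0))/computes_var0. Qed.

Lemma computes_var2 k : computes k.+3 (fun v => head 0 (behead (behead v))).
Proof. exact/(computes_behead (f := fun v => head 0 (behead v)))/computes_var1. Qed.

Lemma computes_var3 k :
  computes k.+4 (fun v => head 0 (behead (behead (behead v)))).
Proof.
exact/(computes_behead (f := fun v => head 0 (behead (behead v))))/computes_var2.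
Qed.

Lemma computes_app1 F k f :
  computes 1 (fun v => F (head 0 v)) -> computes k f ->
  computes k (fun v => F (f v)).
Proof.
move=> [p pP] [q qP]; exists (RComp p [:: q]) => v vk.
apply: (ev_comp (ys := [:: f v])); last exact: pP [:: f v] _.
by constructor; [exact: qP | constructor].
Qed.

Lemma computes_app2 F k f g :
  computes 2 (fun v => F (head 0 v) (head 0 (behead v))) ->
  computes k f -> computes k g -> computes k (fun v => F (f v) (g v)).
Proof.
move=> [p pP] [q qP] [r rP]; exists (RComp p [:: q; r]) => v vk.
apply: (ev_comp (ys := [:: f v; g v])); last exact: pP [:: f v; g v] _.
by constructor; [exact: qP | constructor; [exact: rP | constructor]].
Qed.

Lemma computes_succ k f : computes k f -> computes k (fun v => (f v).+1).
Proof.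
apply: computes_app1; exists RSucc => -[|x [|? ?]] //= _; exact: ev_succ.
Qed.

Lemma computes_const k n : computes k (fun=> n).
Proof.
by elim: n => [|n]; [exists RZero => v _; constructor | exact: computes_succ].
Qed.

Fixpoint primrec (z : nat) (s : nat -> nat -> nat) n :=
  if n is m.+1 then s m (primrec z s m) else z.

(** [RPrim] recurses on its first argument, so the value of [n] is put in front of a copy of the
    context. The step then sees the counter, the accumulator and the context, in this order. *)
Lemma computes_primrec k n z s : computes k n -> computes k z ->
  computes k.+2 (fun v => s (behead (behead v)) (head 0 v) (head 0 (behead v))) ->
  computes k (fun v => primrec (z v) (s v) (n v)).
Proof.
move=> [pn nP] [pz zP] [ps sP].
exists (RComp (RPrim pz ps) (pn :: map RProj (iota 0 k))) => v vk.
apply: (ev_comp (ys := n v :: v)).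
  by constructor; [exact: nP | rewrite -vk; exact: evalrs_proj_id].
elim: (n v) => [|m IHm] /=; first by constructor; exact: zP.
apply: ev_primS IHm _; apply: (sP [:: m, _ & v]); by rewrite /= vk.
Qed.

Lemma computes_iter k n z s : computes k n -> computes k z ->
  computes k.+1 (fun v => s (behead v) (head 0 v)) ->
  computes k (fun v => iter (n v) (s v) (z v)).
Proof.
move=> cn cz cs.
apply: (@eq_computes _ (fun v => primrec (z v) (fun=> s v) (n v))) => [v _|].
  by elim: (n v) => //= m ->.
apply: (computes_primrec (s := fun v _ => s v)) => //.
apply: eq_computes (computes_behead cs) => -[|x [|y v]] //=.
Qed.

Lemma computes_pred k f : computes k f -> computes k (fun v => (f v).-1).
Proof.
apply: computes_app1.
apply: (@eq_computes _ (fun v => primrec 0 (fun i _ => i) (head 0 v))) => [v _|].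
  by case: (head 0 v).
apply: (computes_primrec (s := fun _ i _ => i)); [exact: computes_var0
  | exact: computes_const | exact: computes_var0].
Qed.

Lemma computes_add k f g : computes k f -> computes k g ->
  computes k (fun v => f v + g v).
Proof.
move=> cf cg; apply: (@eq_computes _ (fun v => iter (f v) succn (g v))) => [v _|].
  by elim: (f v) => //= m ->.
by apply: (computes_iter (s := fun=> succn)) => //;
  exact/computes_succ/computes_var0.
Qed.

Lemma computes_sub k f g : computes k f -> computes k g ->
  computes k (fun v => f v - g v).
Proof.
move=> cf cg; apply: (@eq_computes _ (fun v => iter (g v) predn (f v))) => [v _|].
  by elim: (g v) => [|m /= ->]; rewrite ?subn0 // subnS.
by apply: (computes_iter (s := fun=> predn)) => //;
  exact/computes_pred/computes_var0.
Qed.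

Lemma computes_mul k f g : computes k f -> computes k g ->
  computes k (fun v => f v * g v).
Proof.
move=> cf cg; apply: (@eq_computes _ (fun v => iter (f v) (addn (g v)) 0)) => [v _|].
  by elim: (f v) => //= m ->; rewrite mulSn.
apply: (computes_iter (s := fun v => addn (g v))) => //; first exact: computes_const.
by apply: computes_add; [exact: computes_behead | exact: computes_var0].
Qed.

Lemma computes_exp2 k f : computes k f -> computes k (fun v => 2 ^ f v).
Proof.
move=> cf; apply: (@eq_computes _ (fun v => iter (f v) (muln 2) 1)) => [v _|].
  by elim: (f v) => //= m ->; rewrite expnS.
apply: (computes_iter (s := fun=> muln 2)) => //; first exact: computes_const.
by apply: computes_mul; [exact: computes_const | exact: computes_var0].
Qed.

(** Truncated subtraction vanishes exactly when [f v <= g v]. Booleans are read as 0 and 1 through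
    the coercion to [nat]. *)
Lemma computes_leq k f g : computes k f -> computes k g ->
  computes k (fun v => f v <= g v).
Proof.
move=> cf cg; apply: (@eq_computes _ (fun v => 1 - (f v - g v))) => [v _|]; first lia.
by do ?apply: computes_sub => //; exact: computes_const.
Qed.

Lemma computes_neg k P : computes k (fun v => P v : bool) ->
  computes k (fun v => ~~ P v).
Proof.
move=> cP; apply: (@eq_computes _ (fun v => 1 - P v)) => [v _|]; first by case: (P v).
by apply: computes_sub => //; exact: computes_const.
Qed.

Lemma computes_and k P Q : computes k (fun v => P v : bool) ->
  computes k (fun v => Q v : bool) -> computes k (fun v => P v && Q v).
Proof.
move=> cP cQ; apply: (@eq_computes _ (fun v => P v * Q v)) => [v _|].
  by rewrite mulnb.
exact: computes_mul.
Qed.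

Lemma computes_or k P Q : computes k (fun v => P v : bool) ->
  computes k (fun v => Q v : bool) -> computes k (fun v => P v || Q v).
Proof.
move=> cP cQ; apply: (@eq_computes _ (fun v => ~~ (~~ P v && ~~ Q v))) => [v _|].
  by rewrite negb_and !negbK.
exact/computes_neg/computes_and/computes_neg/cQ/computes_neg.
Qed.

Lemma computes_imp k P Q : computes k (fun v => P v : bool) ->
  computes k (fun v => Q v : bool) -> computes k (fun v => P v ==> Q v).
Proof.
move=> cP cQ; apply: (@eq_computes _ (fun v => ~~ P v || Q v)) => [v _|].
  by rewrite implybE.
exact/computes_or/cQ/computes_neg.
Qed.

Lemma computes_eq k f g : computes k f -> computes k g ->
  computes k (fun v => f v == g v).
Proof.
move=> cf cg; apply: (@eq_computes _ (fun v => (f v <= g v) && (g v <= f v))) => [v _|].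
  by rewrite eqn_leq.
by apply: computes_and; exact: computes_leq.
Qed.

Lemma computes_if k P f g : computes k (fun v => P v : bool) -> computes k f ->
  computes k g -> computes k (fun v => if P v then f v else g v).
Proof.
move=> cP cf cg.
apply: (@eq_computes _ (fun v => P v * f v + (~~ P v) * g v)) => [v _|].
  by case: (P v); rewrite /= ?mul1n ?mul0n ?addn0.
by apply: computes_add; apply: computes_mul => //; exact: computes_neg.
Qed.

Lemma computes_mem k f (s : seq nat) : computes k f ->
  computes k (fun v => f v \in s).
Proof.
move=> cf; elim: s => [|n s IHs]; first exact: computes_const.
apply: (@eq_computes _ (fun v => (f v == n) || (f v \in s))) => [v _|].
  by rewrite inE.
by apply: computes_or => //; apply: computes_eq => //; exact: computes_const.
Qed.

Lemma computes_sum k n F : computes k n ->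
  computes k.+1 (fun v => F (behead v) (head 0 v)) ->
  computes k (fun v => \sum_(i < n v) F v i).
Proof.
move=> cn cF.
apply: (@eq_computes _ (fun v => primrec 0 (fun i m => m + F v i) (n v))) => [v _|].
  by elim: (n v) => [|m /= ->]; rewrite ?big_ord0 ?big_ord_recr.
apply: (computes_primrec (s := fun v i m => m + F v i)) => //.
  exact: computes_const.
apply: computes_add; first exact: computes_var1.
(* The summand must not see the accumulator at position 1, so its program is composed with the
   projections 0, 2, 3, and so on. *)
case: cF => p pP.
exists (RComp p (map RProj (0 :: iota 2 k))) => -[|x [|y v]] //= [vk].
apply: (ev_comp (ys := x :: v)); last by apply: (pP (x :: v)); rewrite /= vk.
constructor; first exact: (@ev_proj 0 [:: x, y & v]).
rewrite -[X in evalrs _ _ X](mkseq_nth 0) /mkseq vk.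
rewrite (_ : map (nth 0 v) _ = map (nth 0 [:: x, y & v]) (iota 2 k)); last first.
  by rewrite -[2]addn0 iotaDl -map_comp.
apply: evalrs_proj; apply/allP => i; rewrite mem_iota /= vk; lia.
Qed.

(** * Bounded quantifiers *)

Definition bex n (P : pred nat) := has P (iota 0 n).
Definition ball n (P : pred nat) := all P (iota 0 n).

Lemma bexP n (P : pred nat) : reflect (exists2 i, i < n & P i) (bex n P).
Proof. by apply: (iffP hasP) => -[i iP Pi]; exists i; move: iP; rewrite // mem_iota. Qed.

Lemma ballP n (P : pred nat) : reflect (forall i, i < n -> P i) (ball n P).
Proof.
by apply: (iffP allP) => nP i iP; apply: nP; move: iP; rewrite mem_iota.
Qed.

(** A witness below the bound exists exactly when the sum of the truth values is positive. *)
Lemma computes_bex k n P : computes k n ->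
  computes k.+1 (fun v => P (behead v) (head 0 v) : bool) ->
  computes k (fun v => bex (n v) (P v)).
Proof.
move=> cn cP.
apply: (@eq_computes _ (fun v => 0 < \sum_(i < n v) P v i)) => [v _|].
  congr nat_of_bool; apply/idP/bexP => [|[i iP Pi]].
    rewrite lt0n sum_nat_eq0 negb_forall => /existsP[i].
    by rewrite implyTb eqb0 negbK; exists i.
  by rewrite (bigD1 (Ordinal iP)) //= Pi.
apply: computes_leq; first exact: computes_const.
exact: (computes_sum (F := fun v i => P v i)).
Qed.

Lemma computes_ball k n P : computes k n ->
  computes k.+1 (fun v => P (behead v) (head 0 v) : bool) ->
  computes k (fun v => ball (n v) (P v)).
Proof.
move=> cn cP.
apply: (@eq_computes _ (fun v => ~~ bex (n v) (fun i => ~~ P v i))) => [v _|].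
  by rewrite /bex /ball has_predC negbK.
apply/computes_neg/(computes_bex (P := fun v i => ~~ P v i)) => //.
exact: computes_neg.
Qed.

Create HintDb computes.
#[local] Hint Resolve computes_var0 computes_var1 computes_var2 computes_var3
  computes_succ computes_const computes_pred computes_add computes_sub
  computes_mul computes_exp2 computes_leq computes_neg computes_and computes_or
  computes_imp computes_eq computes_if computes_mem : computes.

(** * Codes of sequences, transitions and automata *)

Import CodeSeq.

Definition chd c := head 0 (decode c).
Definition ctl c := code (behead (decode c)).

Lemma code_cons i m : 2 ^ i * m.*2.+1 = code (i :: decode m).
Proof. by rewrite /= decodeK. Qed.

Lemma sum_unique n (F : pred nat) i0 : i0 < n -> (forall i, F i -> i = i0) -> F i0 ->
  \sum_(i < n) i * F i = i0.
Proof.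
move=> i0n uniqF Fi0; rewrite (bigD1 (Ordinal i0n)) //= Fi0 muln1 big1 ?addn0 //.
move=> i ii0; case Fi: (F i); rewrite ?muln0 //.
by move: ii0; rewrite -val_eqE /= (uniqF i Fi) eqxx.
Qed.

(* [i] and [m] are the unique ones with [c = 2 ^ i * (2 * m + 1)], hence sums
   over all candidates pick them out. *)
Lemma chdE c : chd c =
  \sum_(i < c) i * bex c (fun m => c == 2 ^ i * m.*2.+1).
Proof.
rewrite /chd; case dc: (decode c) => [|n s] /=.
  by rewrite -[c]decodeK dc big_ord0.
have cE : c = 2 ^ n * (code s).*2.+1 by rewrite -[c]decodeK dc.
have sc : code s < c.
  by rewrite cE -[_.+1]mul1n leq_mul ?expn_gt0 //; lia.
apply/esym/(sum_unique (F := fun i => bex c (fun m => c == 2 ^ i * m.*2.+1))).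
- by have /allP := gtn_decode c; apply; rewrite dc mem_head.
- by move=> i /bexP[m _ /eqP]; rewrite code_cons => /(congr1 decode);
    rewrite dc codeK => -[].
- by apply/bexP; exists (code s) => //; apply/eqP.
Qed.

Lemma ctlE c : ctl c =
  \sum_(m < c) m * bex c (fun i => c == 2 ^ i * m.*2.+1).
Proof.
rewrite /ctl; case dc: (decode c) => [|n s] /=.
  by rewrite -[c]decodeK dc big_ord0.
have cE : c = 2 ^ n * (code s).*2.+1 by rewrite -[c]decodeK dc.
have sc : code s < c.
  by rewrite cE -[_.+1]mul1n leq_mul ?expn_gt0 //; lia.
apply/esym/(sum_unique (F := fun m => bex c (fun i => c == 2 ^ i * m.*2.+1))).
- by [].
- by move=> m /bexP[i _ /eqP]; rewrite code_cons => /(congr1 decode);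
    rewrite dc codeK => -[_ ->]; rewrite decodeK.
- apply/bexP; exists n; last exact/eqP.
  by have /allP := gtn_decode c; apply; rewrite dc mem_head.
Qed.

Lemma computes_double k f : computes k f -> computes k (fun v => (f v).*2).
Proof.
move=> cf; apply: (@eq_computes _ (fun v => f v + f v)) => [v _|].
  by rewrite addnn.
exact: computes_add.
Qed.
#[local] Hint Resolve computes_double : computes.

Lemma computes_chd k f : computes k f -> computes k (fun v => chd (f v)).
Proof.
apply: computes_app1; apply: (eq_computes (fun v _ => esym (chdE (head 0 v)))).
apply: (computes_sum (F := fun v i => i * bex (head 0 v)
  (fun m => head 0 v == 2 ^ i * m.*2.+1))); first exact: computes_var0.
apply: computes_mul; first exact: computes_var0.
apply: (computes_bex (P := fun v m => _ == _)); eauto 20 with computes.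
Qed.

Lemma computes_ctl k f : computes k f -> computes k (fun v => ctl (f v)).
Proof.
apply: computes_app1; apply: (eq_computes (fun v _ => esym (ctlE (head 0 v)))).
apply: (computes_sum (F := fun v m => m * bex (head 0 v)
  (fun i => head 0 v == 2 ^ i * m.*2.+1))); first exact: computes_var0.
apply: computes_mul; first exact: computes_var0.
apply: (computes_bex (P := fun v m => _ == _)); eauto 20 with computes.
Qed.
#[local] Hint Resolve computes_chd computes_ctl : computes.

Definition cnth c i := nth 0 (decode c) i.
Definition csize c := size (decode c).

Lemma iter_ctl i c : iter i ctl c = code (drop i (decode c)).
Proof.
elim: i => [|i IHi] /=; first by rewrite drop0 decodeK.
by rewrite IHi /ctl codeK -drop1 drop_drop add1n.
Qed.

Lemma computes_iter_ctl k f g : computes k f -> computes k g ->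
  computes k (fun v => iter (f v) ctl (g v)).
Proof.
by move=> cf cg; apply: (computes_iter (s := fun=> ctl)); eauto 20 with computes.
Qed.
#[local] Hint Resolve computes_iter_ctl : computes.

Lemma computes_cnth k f g : computes k f -> computes k g ->
  computes k (fun v => cnth (f v) (g v)).
Proof.
move=> cf cg; apply: (@eq_computes _ (fun v => chd (iter (g v) ctl (f v)))) => [v _|].
  by rewrite iter_ctl /chd codeK -nth0 nth_drop addn0.
by eauto 20 with computes.
Qed.

(** Each entry makes the code strictly larger, so [c] itself bounds the length of the list; this is
    the range of the sum that computes [csize]. *)
Lemma size_decode c : size (decode c) <= c.
Proof.
rewrite -{2}[c]decodeK; elim: (decode c) => //= n s IHs.
by rewrite -[(size s).+1]mul1n leq_mul ?expn_gt0 //; lia.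
Qed.

Lemma sum_ltn n m : \sum_(i < n) (i < m) = minn n m.
Proof.
by elim: n => [|n IHn]; rewrite ?big_ord0 ?min0n // big_ord_recr /= IHn; lia.
Qed.

(** The length counts the [i] whose [i]-th iterated tail is nonempty, that is, has a nonzero
    code. *)
Lemma computes_csize k f : computes k f -> computes k (fun v => csize (f v)).
Proof.
apply: computes_app1.
apply: (@eq_computes _ (fun v => \sum_(i < head 0 v) (0 < iter i ctl (head 0 v)))).
  move=> v _; set c := head 0 v; rewrite /csize.
  transitivity (\sum_(i < c) (i < size (decode c))).
    apply: eq_bigr => i _; rewrite iter_ctl -[i < size _]subn_gt0 -size_drop.
    by case: (drop i _) => //= n s; rewrite muln_gt0 expn_gt0.
  by rewrite sum_ltn; exact/minn_idPr/size_decode.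
apply: (computes_sum (F := fun v i => 0 < iter i ctl (head 0 v) : nat));
  eauto 20 with computes.
Qed.
#[local] Hint Resolve computes_cnth computes_csize : computes.

Definition cmem c y := bex (csize c) (fun i => cnth c i == y).

Lemma cmemE c y : cmem c y = (y \in decode c).
Proof.
apply/bexP/(nthP 0) => -[i ? h]; exists i => //; exact/eqP.
Qed.

Lemma computes_cmem k f g : computes k f -> computes k g ->
  computes k (fun v => cmem (f v) (g v)).
Proof.
apply: (computes_app2 (F := fun c y => cmem c y)).
by apply: (computes_bex (P := fun v i => cnth (head 0 v) i == head 0 (behead v)));
  eauto 20 with computes.
Qed.
#[local] Hint Resolve computes_cmem : computes.

(* The recursion on [n] happens outside the program: [n] is a constant of it. *)
Fixpoint cmap_take (g : nat -> nat) n c :=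
  if n is m.+1 then
    if c == 0 then 0 else 2 ^ g (chd c) * (cmap_take g m (ctl c)).*2.+1
  else 0.

Lemma cmap_takeE g n c : cmap_take g n c = code (map g (take n (decode c))).
Proof.
elim: n c => [|n IHn] c /=; first by rewrite take0.
case: eqP => [->//|c0]; rewrite IHn /ctl codeK /chd.
by case dc: (decode c) => [|m s] //=; case: c0; rewrite -[c]decodeK dc.
Qed.

Lemma computes_cmap_take g n k f :
  computes 1 (fun v => g (head 0 v)) -> computes k f ->
  computes k (fun v => cmap_take g n (f v)).
Proof.
move=> cg; elim: n k f => [|n IHn] k f cf /=; first exact: computes_const.
apply: computes_if; eauto 20 with computes.
apply: computes_mul; last by eauto 20 with computes.
by apply/computes_exp2/(computes_app1 cg)/computes_chd.
Qed.

(** * Codes of pairs, transitions and automata, with size bounds *)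

Definition cfst c := cnth c 0.
Definition csnd c := cnth c 1.

Lemma computes_cfst k f : computes k f -> computes k (fun v => cfst (f v)).
Proof. by move=> cf; apply: computes_cnth => //; exact: computes_const. Qed.

Lemma computes_csnd k f : computes k f -> computes k (fun v => csnd (f v)).
Proof. by move=> cf; apply: computes_cnth => //; exact: computes_const. Qed.
#[local] Hint Resolve computes_cfst computes_csnd : computes.

Lemma pickle_pairE (T1 T2 : countType) (x : T1 * T2) :
  pickle x = code [:: pickle x.1; pickle x.2].
Proof. by []. Qed.

Lemma cfst_pickle (T1 T2 : countType) (x : T1 * T2) : cfst (pickle x) = pickle x.1.
Proof. by rewrite pickle_pairE /cfst /cnth codeK. Qed.

Lemma csnd_pickle (T1 T2 : countType) (x : T1 * T2) : csnd (pickle x) = pickle x.2.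
Proof. by rewrite pickle_pairE /csnd /cnth codeK. Qed.

(** A code exceeds the codes of its components. Hence the code of an automaton bounds its number of
    states, its letters and the codes of its transitions, which supplies the ranges of the bounded
    quantifiers. *)
Lemma pickle_fst_lt (T1 T2 : countType) (x : T1 * T2) : pickle x.1 < pickle x.
Proof.
rewrite pickle_pairE; have /allP := ltn_code [:: pickle x.1; pickle x.2].
by apply; rewrite inE eqxx.
Qed.

Lemma pickle_snd_lt (T1 T2 : countType) (x : T1 * T2) : pickle x.2 < pickle x.
Proof.
rewrite pickle_pairE; have /allP := ltn_code [:: pickle x.1; pickle x.2].
by apply; rewrite !inE eqxx orbT.
Qed.

Lemma decode_pickle_seq (T : countType) (s : seq T) :
  decode (pickle s) = map pickle s.
Proof. exact: codeK. Qed.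

Lemma pickle_mem_lt (T : countType) (s : seq T) x : x \in s -> pickle x < pickle s.
Proof.
move=> xs; have /allP := ltn_code (map pickle s); apply; exact: map_f.
Qed.

(** An entry [n < K] contributes at most the factor [2 ^ n.+1 <= 2 ^ K], because
    [2 ^ n * (2 * m + 1) < 2 ^ n.+1 * (m + 1)]. *)
Lemma code_lt K s : all (fun n => n < K) s -> code s < 2 ^ (K * size s).
Proof.
elim: s => [|n s IHs] /=; first by rewrite muln0.
move=> /andP[nK /IHs {}IHs]; rewrite [K * _]mulnS expnD.
apply: (@leq_trans (2 ^ n.+1 * (code s).+1)).
  by rewrite expnS -mulnA mulnCA; have := expn_gt0 2 n; nia.
by rewrite leq_mul // leq_exp2l.
Qed.

Definition csrc c := cfst (cfst (cfst c)).
Definition clet c := csnd (cfst (cfst c)).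
Definition cdst c := csnd (cfst c).
Definition cwt c := csnd c.

Lemma csrcE (x : trans) : csrc (pickle x) = tsrc x.
Proof. by rewrite /csrc !cfst_pickle. Qed.
Lemma cletE (x : trans) : clet (pickle x) = tlet x.
Proof. by rewrite /clet !cfst_pickle csnd_pickle. Qed.
Lemma cdstE (x : trans) : cdst (pickle x) = tdst x.
Proof. by rewrite /cdst cfst_pickle csnd_pickle. Qed.
Lemma cwtE (x : trans) : cwt (pickle x) = pickle (twt x).
Proof. by rewrite /cwt csnd_pickle. Qed.

Definition cnlet x := csnd (cfst (cfst (cfst x))).
Definition cinit x := csnd (cfst (cfst x)).
Definition cacc x := csnd (cfst x).
Definition cdelta x := csnd x.

Lemma cnletE (A : dsa) : cnlet (pickle A) = dsa_nlet A.
Proof. by rewrite /cnlet !cfst_pickle csnd_pickle. Qed.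
Lemma cinitE (A : dsa) : cinit (pickle A) = dsa_init A.
Proof. by rewrite /cinit !cfst_pickle csnd_pickle. Qed.
Lemma caccE (A : dsa) : cacc (pickle A) = pickle (dsa_acc A).
Proof. by rewrite /cacc !cfst_pickle csnd_pickle. Qed.
Lemma cdeltaE (A : dsa) : cdelta (pickle A) = pickle (dsa_delta A).
Proof. by rewrite /cdelta csnd_pickle. Qed.

(** * The decision program on codes *)

Definition cstate x r i := if i == 0 then cinit x else cdst (cnth r i.-1).

Definition cword x w := ball (csize w) (fun i => cnth w i < cnlet x).

Definition crun x w r := (csize r == csize w) && ball (csize r) (fun i =>
  [&& cmem (cdelta x) (cnth r i), clet (cnth r i) == cnth w i
    & csrc (cnth r i) == cstate x r i]).

(** The code [x] of an automaton exceeds its number [n] of states, so this dominates the bound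
    [N + 2 ^ n] of the shortening argument. *)
Definition wbound N x := N + 2 ^ x.
(** Letters and codes of transitions lie below [x], so every word or run of length at most
    [wbound N x] has a code below this number. *)
Definition cbound N x := 2 ^ (x * wbound N x).

(** The flag [facc] requires the run to end in an accepting state; [tbl] lists the codes of the low
    weight prefixes. *)
Definition crun_check N facc (tbl : seq nat) x w := bex (cbound N x) (fun r =>
  [&& crun x w r, facc ==> cmem (cacc x) (cstate x r (csize r))
    & cmap_take cwt N r \in tbl]).

(** The least length [K] is 0 for automata over finite words, and [N] over infinite words, where
    only prefixes long enough to decide the side of [t] are tested. *)
Definition bounded_check N K facc tbl x := ball (cbound N x) (fun w =>
  [&& cword x w, K <= csize w & csize w <= wbound N x] ==>
  crun_check N facc tbl x w).

Lemma computes_bounded_check N K facc tbl :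
  computes 1 (fun v => bounded_check N K facc tbl (head 0 v)).
Proof.
have ccwt : computes 1 (fun v => cwt (head 0 v)) by rewrite /cwt; eauto with computes.
rewrite /bounded_check.
apply: (computes_ball (n := fun v => cbound N (head 0 v)) (P := fun v w =>
  [&& cword (head 0 v) w, K <= csize w & csize w <= wbound N (head 0 v)] ==>
  crun_check N facc tbl (head 0 v) w)).
  by rewrite /cbound /wbound; eauto 20 with computes.
apply: computes_imp.
  apply: computes_and; last by rewrite /wbound; eauto 20 with computes.
  apply: (computes_ball (n := fun v => csize (head 0 v))
    (P := fun v i => cnth (head 0 v) i < cnlet (head 0 (behead v)))).
    by eauto with computes.
  by rewrite /cnlet; eauto 20 with computes.
(* Each quantifier pushes its variable to the front of the context: here the word precedes the
   automaton, and inside the run precedes both. *)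
apply: (computes_bex (n := fun v => cbound N (head 0 (behead v))) (P := fun v r =>
  [&& crun (head 0 (behead v)) (head 0 v) r,
   facc ==> cmem (cacc (head 0 (behead v))) (cstate (head 0 (behead v)) r (csize r))
    & cmap_take cwt N r \in tbl])).
  by rewrite /cbound /wbound; eauto 20 with computes.
apply: computes_and; last first.
  apply: computes_and.
    apply: computes_imp; first exact: (computes_const _ facc).
    by rewrite /cacc /cstate /cinit /cdst; eauto 20 with computes.
  by apply/computes_mem/computes_cmap_take => //; exact: computes_var0.
apply: computes_and; first by eauto 20 with computes.
apply: (computes_ball (n := fun v => csize (head 0 v)) (P := fun v i =>
  [&& cmem (cdelta (head 0 (behead (behead v)))) (cnth (head 0 v) i),
    clet (cnth (head 0 v) i) == cnth (head 0 (behead v)) i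
  & csrc (cnth (head 0 v) i) == cstate (head 0 (behead (behead v))) (head 0 v) i])).
  by eauto 20 with computes.
rewrite /cdelta /clet /csrc /cstate /cinit /cdst.
by do ![apply: computes_and]; eauto 20 with computes.
Qed.

(** * Correctness of the decision program *)

Lemma cstate_pickle (A : dsa) trs i : i <= size trs ->
  cstate (pickle A) (pickle trs) i = fstate A trs i.
Proof.
case: i => [|i] isz; rewrite /cstate /= ?cinitE //.
by rewrite /cnth decode_pickle_seq (nth_map dtrans) // cdstE.
Qed.

Lemma csize_pickle (T : countType) (s : seq T) : csize (pickle s) = size s.
Proof. by rewrite /csize decode_pickle_seq size_map. Qed.

Lemma crunP (A : dsa) (w : seq nat) (trs : seq trans) :
  reflect (fin_run A w trs) (crun (pickle A) (pickle w) (pickle trs)).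
Proof.
have stepE i : i < size trs ->
    [&& cmem (cdelta (pickle A)) (cnth (pickle trs) i),
        clet (cnth (pickle trs) i) == cnth (pickle w) i
      & csrc (cnth (pickle trs) i) == cstate (pickle A) (pickle trs) i] =
    [&& nth dtrans trs i \in dsa_delta A, tlet (nth dtrans trs i) == nth 0 w i
      & tsrc (nth dtrans trs i) == fstate A trs i].
  move=> isz; rewrite cstate_pickle ?(ltnW isz) //.
  rewrite {1 2 4}/cnth decode_pickle_seq (nth_map dtrans) // cletE csrcE.
  rewrite cmemE cdeltaE decode_pickle_seq (mem_map (pcan_inj pickleK)).
  by rewrite /cnth decode_pickle_seq map_id.
rewrite /crun !csize_pickle.
apply: (iffP andP) => [[/eqP szE /ballP sP]|[szE sP]]; split=> //.
- by move=> i isz; have := sP i isz; rewrite stepE // => /and3P[? /eqP ? /eqP ?].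
- exact/eqP.
- apply/ballP => i isz; rewrite stepE //.
  by have [? ? ?] := sP i isz; apply/and3P; split=> //; exact/eqP.
Qed.

(** Not every number codes a list of transitions. One that passes the check does, since each of its
    entries is found among the codes of the transitions of [A]. *)
Lemma crun_pickle (A : dsa) w r : crun (pickle A) w r ->
  exists trs : seq trans, r = pickle trs.
Proof.
move=> /andP[_ /ballP rP].
have {}rP : all [in map pickle (dsa_delta A)] (decode r).
  apply/(all_nthP 0) => i /rP /and3P[+ _ _].
  by rewrite cmemE cdeltaE decode_pickle_seq.
suff [trs rE] : exists trs : seq trans, decode r = map pickle trs.
  by exists trs; rewrite -[r]decodeK rE.
elim: (decode r) rP => [_|c s IHs /= /andP[cA /IHs[trs ->]]]; first by exists [::].
by have /mapP[x _ ->] := cA; exists (x :: trs).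
Qed.

(** Shorter lists are included as well, because a run of length below [N] is its own prefix. *)
Fixpoint words (T : Type) (a : seq T) n : seq (seq T) :=
  if n is m.+1 then [::] :: [seq x :: u | x <- a, u <- words a m] else [:: [::]].

Lemma mem_words (T : eqType) (a : seq T) n u :
  {subset u <= a} -> size u <= n -> u \in words a n.
Proof.
elim: n u => [|n IHn] [|x u] //= ua un; rewrite inE //=.
apply: allpairs_f; first by apply: ua; rewrite mem_head.
by apply: IHn => // y yu; apply: ua; rewrite inE yu orbT.
Qed.

Definition good_run N (facc : bool) (low : pred (seq rat)) A w trs :=
  [/\ fin_run A w trs, facc -> fin_accepting A trs
    & low (map twt (take N trs))].

Definition bounded_universal N K facc low A := forall w, fin_word A w ->
  K <= size w -> size w <= wbound N (pickle A) ->
  exists trs, good_run N facc low A w trs.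

(* The program never decodes a rational: weights are compared as codes. *)
Definition low_table (a : seq rat) N (low : pred (seq rat)) : seq nat :=
  [seq pickle u | u <- words a N & low u].

Lemma fin_run_delta A w trs : fin_run A w trs -> {subset trs <= dsa_delta A}.
Proof. by move=> [_ rP] x /(nthP dtrans)[i /rP[xA _ _] <-]. Qed.

Lemma class_weights a A trs : dsa_in_class a A ->
  {subset trs <= dsa_delta A} -> {subset map twt trs <= a}.
Proof.
move=> [_ _ /allP deltaP _] trsA _ /mapP[x /trsA/deltaP xP ->].
by case/and4P: xP.
Qed.

(** The prefix has at most [N] weights, all from [a], so it occurs in [words a N]; injectivity of
    [pickle] then turns the table lookup into [low]. *)
Lemma mem_low_table a N low A w trs : dsa_in_class a A -> fin_run A w trs ->
  (cmap_take cwt N (pickle trs) \in low_table a N low) = low (map twt (take N trs)).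
Proof.
move=> Aa runP; rewrite cmap_takeE decode_pickle_seq -map_take -map_comp.
have -> : code (map (cwt \o pickle) (take N trs)) = pickle (map twt (take N trs)).
  by congr code; rewrite -map_comp; apply: eq_map => x; rewrite /= cwtE.
rewrite /low_table (mem_map (pcan_inj pickleK)) mem_filter mem_words ?andbT //.
  apply: class_weights Aa _ => x /mem_take; exact: fin_run_delta runP x.
by rewrite size_map size_take_min geq_minl.
Qed.

Lemma crun_checkP a N facc low A w : dsa_in_class a A -> fin_word A w ->
  size w <= wbound N (pickle A) ->
  reflect (exists trs, good_run N facc low A w trs)
    (crun_check N facc (low_table a N low) (pickle A) (pickle w)).
Proof.
move=> Aa wA wN; apply: (iffP (bexP _ _)) => [[r _ /and3P[]]|[trs [runP accP lowP]]].
  move=> rP; have [trs rE] := crun_pickle rP; move: rP; rewrite {}rE => /crunP runP.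
  rewrite (mem_low_table _ _ Aa runP) csize_pickle cstate_pickle // cmemE caccE.
  rewrite decode_pickle_seq map_id => /implyP accP lowP.
  by exists trs.
exists (pickle trs); last first.
  rewrite (mem_low_table _ _ Aa runP) lowP csize_pickle cstate_pickle // cmemE caccE.
  rewrite decode_pickle_seq map_id andbT; apply/andP; split; first exact/crunP.
  exact/implyP.
apply: (@leq_trans (2 ^ (pickle A * size trs))).
  rewrite -[size trs](size_map pickle); apply: code_lt.
  apply/allP => _ /mapP[x /(fin_run_delta runP)/pickle_mem_lt xA ->].
  by apply: ltn_trans xA _; exact: pickle_snd_lt.
by rewrite leq_exp2l // leq_mul2l runP.1 wN orbT.
Qed.

Lemma cwordP (A : dsa) (w : seq nat) :
  reflect (fin_word A w) (cword (pickle A) (pickle w)).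
Proof.
rewrite /cword csize_pickle cnletE /cnth decode_pickle_seq map_id.
by apply: (iffP (ballP _ _)) => [|/(all_nthP 0)//]; move=> h; exact/(all_nthP 0).
Qed.

Lemma dsa_nst_lt (A : dsa) : dsa_nst A < pickle A.
Proof.
exact: ltn_trans (pickle_fst_lt A.1.1.1) (ltn_trans (pickle_fst_lt A.1.1)
  (ltn_trans (pickle_fst_lt A.1) (pickle_fst_lt A))).
Qed.

Lemma dsa_nlet_lt (A : dsa) : dsa_nlet A < pickle A.
Proof.
exact: ltn_trans (pickle_snd_lt A.1.1.1) (ltn_trans (pickle_fst_lt A.1.1)
  (ltn_trans (pickle_fst_lt A.1) (pickle_fst_lt A))).
Qed.

Lemma bounded_checkP a N K facc low A : dsa_in_class a A ->
  bounded_check N K facc (low_table a N low) (pickle A) = true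
  <-> bounded_universal N K facc low A.
Proof.
move=> Aa; split=> [/ballP checkP w wA Kw wN|univ].
  apply/(crun_checkP _ _ Aa wA wN); have := checkP (pickle w).
  rewrite csize_pickle Kw wN (introT (cwordP _ _) wA) /=; apply.
  apply: (@leq_trans (2 ^ (pickle A * size w))).
    rewrite -[size w](size_map pickle); apply: code_lt; rewrite map_id.
    by apply: sub_all wA => s sA; exact: ltn_trans sA (dsa_nlet_lt A).
  by rewrite leq_exp2l // leq_mul2l wN orbT.
(* Every number codes some list of numbers, [pickle] being the identity on [nat]; so ranging over
   numbers is ranging over words. *)
apply/ballP => c _; have -> : c = pickle (decode c).
  by rewrite -{1}[c]decodeK -[X in code X]map_id.
apply/implyP; rewrite csize_pickle => /and3P[/cwordP wA Kw wN].
by apply/(crun_checkP _ _ Aa wA wN); exact: univ.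
Qed.

(** Only the finitely many values of [low] on [words a N] matter, and these are built into the
    program as a table. *)
Lemma decidable_bounded_universal a N K facc low :
  decidable_over (dsa_in_class a) (bounded_universal N K facc low).
Proof.
have [p pP] := computes_bounded_check N K facc (low_table a N low).
exists p => A Aa; exists (bounded_check N K facc (low_table a N low) (pickle A)).
by split; [exact: pP [:: pickle A] _ | exact: bounded_checkP].
Qed.

(** * Koenig's lemma and the subset construction *)

(** As [a] is finite, a prefix with good continuations of every length has a one-letter extension of
    the same kind. Iterating from the empty list yields the branch. *)
Lemma konig (T : eqType) (a : seq T) (P : seq T -> Prop) :
  (forall u n, P u -> P (take n u)) ->
  (forall n, exists u, [/\ size u = n, {subset u <= a} & P u]) ->
  exists f : nat -> T, (forall i, f i \in a) /\ forall n, P (mkseq f n).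
Proof.
move=> Ptake Pn.
pose ext u := forall n, exists v, [/\ size v = n, {subset v <= a} & P (u ++ v)].
have ext_step u : ext u -> exists x, x \in a /\ ext (rcons u x).
  move=> extu; apply: contrapT => /forallNP noext.
  have /choice[h hP] : forall x, exists n, x \in a ->
      forall v, size v = n -> {subset v <= a} -> ~ P (rcons u x ++ v).
    move=> x; apply: contrapT => /forallNP noh; apply: (noext x).
    have xa : x \in a by apply: contrapT => xa; apply: (noh 0).
    split=> // n; apply: contrapT => /forallNP nov.
    by apply: (noh n) => _ v vn va Pv; apply: (nov v); split.
  (* If every letter [x] failed at some length [h x], a continuation longer than all these lengths
     would start with some [x], and cutting it after [h x] further letters would contradict the
     choice of [h x]. *)
  have [[|x v] [] //= [vn] va Pv] := extu (\max_(x <- a) h x).+1.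
  have xa : x \in a by apply: va; rewrite mem_head.
  apply: (hP x xa (take (h x) v)).
  - by rewrite size_takel // vn; exact: leq_bigmax_seq.
  - by move=> y /mem_take yv; apply: va; rewrite inE yv orbT.
  - have := Ptake _ (size u + (h x).+1) Pv.
    by rewrite take_cat ltnNge leq_addr addKn cat_rcons.
have ext0 : ext [::] by [].
(* [x0] is a default for lists without arbitrarily long continuations, so that the choice function
   is total. *)
have [x0 _] := ext_step _ ext0.
have /choice[g gP] : forall u, exists x, ext u -> x \in a /\ ext (rcons u x).
  move=> u; have [/ext_step[x xP]|nextu] := pselect (ext u); first by exists x.
  by exists x0.
pose U n := iter n (fun u => rcons u (g u)) [::].
have extU n : ext (U n) by elim: n => //= n /gP[].
exists (g \o U); split=> [i|n]; first by have [] := gP _ (extU i).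
have -> : mkseq (g \o U) n = U n.
  by elim: n => //= n IHn; rewrite mkseqS IHn.
by have [v [/size0nil -> _]] := extU n 0; rewrite cats0.
Qed.

Lemma fstate_rcons A trs x i :
  fstate A (rcons trs x) i =
  if i <= size trs then fstate A trs i
  else if i == (size trs).+1 then tdst x else tdst dtrans.
Proof.
by case: i => [|i] //=; rewrite nth_rcons eqSS !(fun_if tdst).
Qed.

Lemma fin_run_rcons A w s trs x :
  fin_run A (rcons w s) (rcons trs x) <->
  [/\ fin_run A w trs, x \in dsa_delta A, tlet x = s
    & tsrc x = fstate A trs (size trs)].
Proof.
split=> [[]|[[szE runP] xA xs xsrc]].
  rewrite !size_rcons => -[szE] runP; split.
  - split=> // i isz; have [|] := runP i; first exact: ltnW.
    by rewrite fstate_rcons !nth_rcons -szE isz (ltnW isz).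
  - by have [|] := runP (size trs) => //; rewrite nth_rcons ltnn eqxx.
  - have [|_] := runP (size trs) => //.
    by rewrite !nth_rcons -szE ltnn eqxx.
  - have [|_ _] := runP (size trs) => //.
    by rewrite fstate_rcons nth_rcons ltnn eqxx leqnn.
split=> [|i]; rewrite !size_rcons ?szE // fstate_rcons !nth_rcons -szE ltnS => isz.
rewrite isz; case: ltngtP isz => // [isz _|->]; first exact: runP.
by split.
Qed.

Lemma fin_run_take A w trs n :
  fin_run A w trs -> fin_run A (take n w) (take n trs).
Proof.
move=> [szE runP]; split=> [|i]; first by rewrite !size_take szE.
rewrite size_take_min ltn_min => /andP[iN isz].
have := runP i isz; rewrite !nth_take //; case: i iN isz => [|i] //= iN isz.
by rewrite nth_take // ltnW.
Qed.

(** * Sets of states reached by low runs *)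

Section SubsetConstruction.
Variables (a : seq rat) (A : dsa) (N : nat) (low : pred (seq rat)).
Hypothesis Aa : dsa_in_class a A.

(** For [w] of length at least [N], the set of these [q] is the state of the subset construction
    after reading [w]. *)
Definition reaches w q := exists trs,
  [/\ fin_run A w trs, low (map twt (take N trs)) & fstate A trs (size trs) = q].

Lemma fstate_lt w trs : fin_run A w trs -> fstate A trs (size trs) < dsa_nst A.
Proof.
case: Aa => init_lt _ /allP deltaP _ /fin_run_delta.
case/lastP: trs => [|trs x] //= trsA; rewrite size_rcons /= nth_rcons ltnn eqxx.
have xA : x \in dsa_delta A by apply: trsA; rewrite mem_rcons mem_head.
by have /and4P[] := deltaP _ xA.
Qed.

(** The first [N] weights are already fixed by a run on [w], so one more transition does not affect
    lowness, and the new set depends only on the old one and on [s]. *)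
Lemma reaches_rcons w s q : N <= size w -> reaches (rcons w s) q <->
  exists x, [/\ x \in dsa_delta A, tlet x = s, tdst x = q & reaches w (tsrc x)].
Proof.
move=> Nw; split=> [[trs []]|[x [xA xs xq [trs [runP lowP trsq]]]]].
  case/lastP: trs => [|trs x]; first by case; rewrite size_rcons.
  move=> /fin_run_rcons[runP xA xs xsrc] lowP dstE; exists x; split=> //.
    by move: dstE; rewrite fstate_rcons size_rcons ltnn eqxx.
  exists trs; split=> //.
  by move: lowP; rewrite -cats1 takel_cat // runP.1.
exists (rcons trs x); split.
- by apply/fin_run_rcons; split.
- by rewrite -cats1 takel_cat // runP.1.
- by rewrite fstate_rcons size_rcons ltnn eqxx.
Qed.

Lemma eq_reaches_cat w w' v : N <= size w -> N <= size w' ->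
  (forall q, reaches w q <-> reaches w' q) ->
  forall q, reaches (w ++ v) q <-> reaches (w' ++ v) q.
Proof.
move=> Nw Nw' ww'; elim/last_ind: v => [|v s IHv] q; first by rewrite !cats0.
rewrite -!rcons_cat !reaches_rcons ?size_cat; [|lia|lia].
by split=> -[x [? ? ?] /IHv]; exists x.
Qed.

(** Among the [2 ^ n + 1] prefixes of lengths [N] to [N + 2 ^ n], with [n] the number of states, two
    reach the same set. Cutting out the segment between them preserves the set reached at the
    end. *)
Lemma reaches_shrink w : fin_word A w -> N + 2 ^ dsa_nst A <= size w ->
  exists w', [/\ fin_word A w', size w' < size w, N <= size w'
    & forall q, reaches w q <-> reaches w' q].
Proof.
move=> wA szw.
pose R (i : 'I_(2 ^ dsa_nst A).+1) : {set 'I_(dsa_nst A)} :=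
  [set q : 'I_(dsa_nst A) | `[< reaches (take (N + i) w) q >]].
have : ~~ injectiveb R.
  apply/negP => /injectiveP /leq_card.
  rewrite card_ord -[X in _ < X -> _]cardsT -powersetT card_powerset cardsT card_ord.
  by rewrite ltnn.
move=> /injectivePn[i [j ij Rij]].
wlog ltij : i j ij Rij / i < j => [hwlog|].
  have := ij; rewrite neq_ltn => /orP[] ?; first exact: hwlog Rij _.
  by apply: hwlog (esym Rij) _ => //; rewrite eq_sym.
have szj : N + j <= size w by have := ltn_ord j; lia.
exists (take (N + i) w ++ drop (N + j) w); split.
- rewrite /fin_word all_cat; apply/andP; split; apply/allP => s.
    by move=> /mem_take; exact: (allP wA).
  by move=> /mem_drop; exact: (allP wA).
- by rewrite size_cat size_takel ?size_drop; lia.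
- by rewrite size_cat size_takel; lia.
- move=> q; rewrite -{1}[w](cat_take_drop (N + j)).
  apply: eq_reaches_cat; rewrite ?size_takel; try lia.
  (* [Rij] compares only states below [dsa_nst A]; any other [p] is reached by neither prefix. *)
  move=> p; have [pn|pn] := ltnP p (dsa_nst A); last first.
    by split=> -[trs [/fstate_lt + _ pE]]; rewrite pE ltnNge pn.
  have := congr1 (fun S : {set _} => Ordinal pn \in S) Rij.
  by rewrite !inE => /(congr1 is_true); rewrite !asboolE /= => ->.
Qed.

Lemma reaches_short w : fin_word A w -> N <= size w ->
  exists w', [/\ fin_word A w', size w' <= N + 2 ^ dsa_nst A, N <= size w'
    & forall q, reaches w q <-> reaches w' q].
Proof.
have [n] := ubnP (size w); elim: n w => // n IHn w wn wA Nw.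
have [wsz|/ltnW wsz] := leqP (size w) (N + 2 ^ dsa_nst A).
  by exists w; split.
have [w1 [w1A w1w Nw1 ww1]] := reaches_shrink wA wsz.
have [|w2 [w2A w2sz Nw2 w12]] := IHn w1 _ w1A Nw1; first by lia.
by exists w2; split=> // q; rewrite ww1.
Qed.

Lemma good_run_reaches facc w : (exists trs, good_run N facc low A w trs) <->
  exists q, reaches w q /\ (facc -> q \in dsa_acc A).
Proof.
split=> [[trs [runP accP lowP]]|[q [[trs [runP lowP <-]] accP]]].
  by exists (fstate A trs (size trs)); split=> //; exists trs.
by exists trs.
Qed.

(** A word of length at least [N] shrinks to one within the bound, still of length at least [N >= K]
    and reaching the same states. A word shorter than [N] is within the bound already. *)
Lemma bounded_universal_all K facc : K <= N ->
  bounded_universal N K facc low A <->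
  forall w, fin_word A w -> K <= size w -> exists trs, good_run N facc low A w trs.
Proof.
move=> KN; split=> [univ w wA Kw|univ w wA Kw _]; last exact: univ.
have bound_le : N + 2 ^ dsa_nst A <= wbound N (pickle A).
  by rewrite leq_add2l leq_exp2l // ltnW // dsa_nst_lt.
have [Nw|wN] := leqP N (size w); last first.
  by apply: univ => //; move: bound_le; lia.
have [w' [w'A szw' Nw' ww']] := reaches_short wA Nw.
have /good_run_reaches[q [qw' qacc]] : exists trs, good_run N facc low A w' trs.
  by apply: univ => //; lia.
by apply/good_run_reaches; exists q; rewrite ww'.
Qed.

End SubsetConstruction.

(** * Discounted sums *)

Import numFieldNormedType.Exports.
Local Open Scope ring_scope.
Local Open Scope classical_set_scope.

(** Values are kept in [rat], which makes comparisons with [t] boolean. *)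
Definition dsum (lam : rat) (u : seq rat) : rat :=
  \sum_(i < size u) lam ^+ i * nth 0 u i.

Lemma dsum_rcons lam u x : dsum lam (rcons u x) = dsum lam u + lam ^+ size u * x.
Proof.
rewrite /dsum size_rcons big_ord_recr /= nth_rcons ltnn eqxx; congr (_ + _).
by apply: eq_bigr => i _; rewrite nth_rcons ltn_ord.
Qed.

Lemma dsum_mkseq lam f n : dsum lam (mkseq f n) = \sum_(i < n) lam ^+ i * f i.
Proof.
by rewrite /dsum size_mkseq; apply: eq_bigr => i _; rewrite nth_mkseq.
Qed.

Lemma fin_valueE (R : realType) lam trs :
  fin_value R lam trs = ratr (dsum lam (map twt trs)).
Proof.
rewrite /fin_value /dsum size_map rmorph_sum /=; apply: eq_bigr => i _.
by rewrite rmorphM rmorphXn /= (nth_map dtrans).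
Qed.

Lemma series_dsum (R : realType) lam f n :
  series (fun i => ratr lam ^+ i * ratr (f i) : R) n = ratr (dsum lam (mkseq f n)).
Proof.
rewrite /series /= big_mkord dsum_mkseq rmorph_sum /=.
by apply: eq_bigr => i _; rewrite rmorphM rmorphXn.
Qed.

Section Discounting.
Variables (lam t : rat) (a : seq rat).
Hypotheses (lam_gt0 : 0 < lam) (lam_lt1 : lam < 1).

(** A bound on the absolute values of the weights; the summand 1 keeps it, and hence [tail],
    positive even if all weights vanish. *)
Definition wmax : rat := 1 + \sum_(x <- a) `|x|.

(* [\sum_(i >= n) lam ^+ i * wmax] *)
Definition tail n : rat := lam ^+ n * (wmax / (1 - lam)).

Lemma wmax_ge x : x \in a -> `|x| <= wmax.
Proof.
move=> xa; rewrite /wmax (big_rem x) //=.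
rewrite addrCA lerDl addr_ge0 // ?sumr_ge0 //.
Qed.

Lemma wmax_gt0 : 0 < wmax.
Proof. by rewrite ltr_pwDl // sumr_ge0. Qed.

Lemma tail_gt0 n : 0 < tail n.
Proof. by rewrite mulr_gt0 ?exprn_gt0 ?divr_gt0 ?wmax_gt0 ?subr_gt0. Qed.

Lemma tailS n : tail n = tail n.+1 + lam ^+ n * wmax.
Proof. by rewrite /tail exprSr; field; rewrite subr_eq0 gt_eqF. Qed.

Lemma tail_le m n : (m <= n)%N -> tail n <= tail m.
Proof.
move=> mn; rewrite ler_pM2r ?divr_gt0 ?wmax_gt0 ?subr_gt0 //.
by rewrite ler_wiXn2l // ltW.
Qed.

(** The entries from position [n] on contribute at most a geometric sum, which telescopes to this
    difference. The subtracted term makes the induction go through and later gives closure under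
    prefixes with the same constant 3. *)
Lemma dsum_take u n : {subset u <= a} -> (n <= size u)%N ->
  `|dsum lam u - dsum lam (take n u)| <= tail n - tail (size u).
Proof.
elim/last_ind: u => [|u x IHu] ua.
  by rewrite leqn0 => /eqP->; rewrite !subrr normr0.
rewrite size_rcons leq_eqVlt => /predU1P[->|].
  by rewrite -(size_rcons u x) take_size !subrr normr0.
rewrite ltnS => nu; rewrite -cats1 takel_cat // cats1 dsum_rcons addrAC.
apply: le_trans (ler_normD _ _) _.
have ux : `|lam ^+ size u * x| <= lam ^+ size u * wmax.
  rewrite normrM ger0_norm ?exprn_ge0 ?(ltW lam_gt0) //.
  rewrite ler_wpM2l ?exprn_ge0 ?(ltW lam_gt0) // wmax_ge //.
  by apply: ua; rewrite mem_rcons mem_head.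
have := IHu _ nu; rewrite (tailS (size u)) => /(_ _)/wrap[|]; last by lra.
by move=> y yu; apply: ua; rewrite mem_rcons inE yu orbT.
Qed.

(** The gap [delta] is uniform in [u], so the dichotomy survives passage to infinite sums and to
    infima. *)
Definition separates N (delta : rat) := forall u, {subset u <= a} -> (N <= size u)%N ->
  (dsum lam (take N u) < t /\ dsum lam u <= t - delta) \/
  (t < dsum lam (take N u) /\ t + delta <= dsum lam u).

Lemma norm_ratr_lam_lt1 (R : realType) : `|ratr lam : R| < 1.
Proof. by rewrite -ratr_norm -[ltRHS](ratr_nat R 1) ltr_rat gtr0_norm. Qed.

Lemma cvg_tail (R : realType) : (ratr (tail n) : R) @[n --> \oo] --> (0 : R).
Proof.
have -> : (fun n => ratr (tail n) : R) =
    geometric (ratr (wmax / (1 - lam))) (ratr lam).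
  by apply/funext => n; rewrite /tail rmorphM rmorphXn /= mulrC.
exact/cvg_geometric/norm_ratr_lam_lt1.
Qed.

(* Compactness: if words of every length came within [3 * tail] of [t], an
   infinite branch of such words would be a solution. *)
Lemma unsolvable_separates (R : realType) : ~ gtds_has_solution R lam t a ->
  exists N delta, [/\ (0 < N)%N, 0 < delta & separates N delta].
Proof.
move=> nosol.
suff [N Nfar] : exists N, forall u, size u = N.+1 -> {subset u <= a} ->
    3 * tail N.+1 < `|dsum lam u - t|.
  (* The later weights move the sum by less than [tail N.+1]; starting farther than three times this
     from [t], it stays on its side at a distance of at least [tail N.+1]. *)
  exists N.+1, (tail N.+1); split=> // [|u ua Nu]; first exact: tail_gt0.
  have := dsum_take ua Nu; have := Nfar (take N.+1 u).
  have := tail_gt0 (size u); have := tail_gt0 N.+1.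
  move=> tN tu /(_ (size_takel Nu) (fun x xu => ua x (mem_take xu))).
  rewrite ler_norml => + /andP[].
  by case: (ltrP 0 (dsum lam (take N.+1 u) - t)) => h;
    [rewrite (gtr0_norm h)|rewrite (ler0_norm h)]; lra.
apply: contrapT => /forallNP near; apply: nosol.
pose P u := `|dsum lam u - t| <= 3 * tail (size u).
(* Cutting [u] back to length [n] costs [tail n - tail (size u)], and [3 * tail (size u) + tail n -
   tail (size u) <= 3 * tail n]. *)
have Ptake u n : {subset u <= a} -> P u -> P (take n u).
  move=> ua; rewrite /P; have [nu|/ltnW nu] := leqP n (size u);
    last by rewrite take_oversize.
  have := dsum_take ua nu; have := tail_le nu; rewrite size_takel //.
  rewrite !ler_norml => ? /andP[? ?] /andP[? ?]; apply/andP; split; lra.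
have [||f [fa fP]] := @konig _ a (fun u => {subset u <= a} /\ P u).
- by move=> u n [ua Pu]; split; [move=> x /mem_take/ua | exact: Ptake].
(* [near n] yields a list of length [n.+1], which is cut to length [n]. *)
- move=> n; have /existsNP[u /not_implyP[un /not_implyP[ua /negP]]] := near n.
  rewrite -leNgt => uP; exists (take n u).
  have ua' : {subset take n u <= a} by move=> x /mem_take/ua.
  split=> //; first by rewrite size_takel // un.
  by split=> //; apply: Ptake => //; rewrite /P un.
exists f; split=> //.
apply: cvg_lim => //.
have -> : (fun i => ratr (f i) * ratr lam ^+ i : R) =
    (fun i => ratr lam ^+ i * ratr (f i)).
  by apply/funext => i; rewrite mulrC.
have c3 : (3 * ratr (tail n) : R) @[n --> \oo] --> (0 : R).
  by rewrite -(mulr0 3); apply: cvgMr; exact: cvg_tail.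
(* Every partial sum along the branch lies within [3 * tail n] of [t], and this distance tends to
   0. *)
apply: (@squeeze_cvgr _ _ _ _ (fun n => ratr t - 3 * ratr (tail n))
  (fun n => ratr t + 3 * ratr (tail n))).
- apply: nearW => n; have [_] := fP n; rewrite /P size_mkseq series_dsum.
  rewrite -(ler_rat R) ratr_norm rmorphB rmorphM /= ratr_nat.
  by rewrite ler_norml => /andP[? ?]; apply/andP; split; lra.
- by rewrite -[X in _ --> X]subr0; apply: cvgB c3; exact: cvg_cst.
- by rewrite -[X in _ --> X]addr0; apply: cvgD c3; exact: cvg_cst.
Qed.

(** Absolute convergence, by comparison with the geometric series of ratio [lam] scaled by
    [wmax]. *)
Lemma is_cvg_discounted (R : realType) f : (forall i, f i \in a) ->
  cvgn (series (fun i => ratr lam ^+ i * ratr (f i) : R)).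
Proof.
move=> fa; apply: normed_cvg.
have lam1 := norm_ratr_lam_lt1 R.
apply: (series_le_cvg _ _ _ (is_cvg_geometric_series (a := ratr wmax) lam1)).
- by move=> n; exact: normr_ge0.
- move=> n /=; rewrite mulr_ge0 ?exprn_ge0 // ler0q; [exact: ltW wmax_gt0 | exact: ltW].
- move=> n; rewrite /geometric /= normrM normrX -!ratr_norm (gtr0_norm lam_gt0) mulrC.
  rewrite ler_wpM2r ?exprn_ge0 ?ler0q ?(ltW lam_gt0) //.
  by rewrite ler_rat wmax_ge.
Qed.

(** The side is read off at length [N]. All later partial sums lie on that side at distance [delta],
    and the weak inequality passes to the limit. *)
Lemma inf_value_separated (R : realType) N delta trs : separates N delta ->
  (forall i, twt (trs i) \in a) ->
  (dsum lam (map twt (mkseq trs N)) < t /\ inf_value R lam trs <= ratr (t - delta)) \/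
  (t < dsum lam (map twt (mkseq trs N)) /\ ratr (t + delta) <= inf_value R lam trs).
Proof.
move=> sep trsa; have cv := @is_cvg_discounted R (twt \o trs) trsa.
have wE n : map twt (mkseq trs n) = mkseq (twt \o trs) n by rewrite /mkseq -map_comp.
have sepn n : (N <= n)%N ->
    (dsum lam (mkseq (twt \o trs) N) < t /\
       dsum lam (mkseq (twt \o trs) n) <= t - delta) \/
    (t < dsum lam (mkseq (twt \o trs) N) /\
       t + delta <= dsum lam (mkseq (twt \o trs) n)).
  move=> Nn; have -> : mkseq (twt \o trs) N = take N (mkseq (twt \o trs) n).
    by rewrite -map_take take_iota (minn_idPl Nn).
  by apply: sep; rewrite ?size_mkseq // => _ /mapP[i _ ->]; exact: trsa.
rewrite wE; have [[ltN _]|[gtN _]] := sepn N (leqnn N); [left|right]; split=> //.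
- apply: limr_le => //; near=> n; rewrite (series_dsum R lam (twt \o trs)) ler_rat.
  have Nn : (N <= n)%N by near: n; exact: nbhs_infty_ge.
  have [[_ //]|[]] := sepn n Nn.
  by rewrite ltNge (ltW ltN).
- apply: limr_ge => //; near=> n; rewrite (series_dsum R lam (twt \o trs)) ler_rat.
  have Nn : (N <= n)%N by near: n; exact: nbhs_infty_ge.
  have [[]|[_ //]] := sepn n Nn.
  by rewrite ltNge (ltW gtN).
Unshelve. all: by end_near. Qed.

End Discounting.

(** * Infima over the runs on a finite word *)

Lemma finite_gap (s : seq rat) t :
  exists2 delta, 0 < delta & forall x, x \in s -> t < x -> t + delta <= x.
Proof.
elim: s => [|y s [d d0 dP]]; first by exists 1.
have [ty|yt] := ltP t y; last first.
  by exists d => // x; rewrite inE => /predU1P[->|/dP//]; rewrite ltNge yt.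
exists (Num.min d (y - t)); first by rewrite lt_min d0 subr_gt0.
move=> x; rewrite inE => /predU1P[->|xs] tx.
  by rewrite -lerBrDl ge_min lexx orbT.
by apply: le_trans (dP x xs tx); rewrite lerD2l ge_min lexx.
Qed.

Lemma fin_A_ltP (R : realType) lam t A w :
  (fin_A R lam A w < (ratr t : R)%:E)%E <->
  exists trs, [/\ fin_run A w trs, fin_accepting A trs
    & dsum lam (map twt trs) < t].
Proof.
split=> [/ereal_inf_ltP[_ [trs [runP accP] <-]]|[trs [runP accP valP]]].
  by rewrite lte_fin fin_valueE ltr_rat; exists trs.
apply/ereal_inf_ltP; exists (fin_value R lam trs)%:E; first by exists trs.
by rewrite lte_fin fin_valueE ltr_rat.
Qed.

(** The values of runs on [w] come from a finite set, so those above [t] stay above it by a fixed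
    gap; an infimum of at most [t] therefore needs a run of value at most [t]. *)
Lemma fin_A_leP (R : realType) lam t a A w : dsa_in_class a A ->
  (fin_A R lam A w <= (ratr t : R)%:E)%E <->
  exists trs, [/\ fin_run A w trs, fin_accepting A trs
    & dsum lam (map twt trs) <= t].
Proof.
move=> Aa; split=> [infP|[trs [runP accP valP]]]; last first.
  apply: ge_ereal_inf; exists (fin_value R lam trs)%:E; first by exists trs.
  by rewrite lee_fin fin_valueE ler_rat.
apply: contrapT => /forallNP norun.
have [d d0 dP] := finite_gap (map (dsum lam) (words a (size w))) t.
suff : ((ratr (t + d) : R)%:E <= fin_A R lam A w)%E.
  by move=> /le_trans/(_ infP); rewrite lee_fin ler_rat gerDl leNgt d0.
apply: le_ereal_inf_tmp => _ [trs [runP accP] <-].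
rewrite lee_fin fin_valueE ler_rat; apply: dP.
  apply/map_f/mem_words; last by rewrite size_map runP.1.
  exact/(class_weights Aa)/fin_run_delta/runP.
by rewrite ltNge; apply/negP => valP; apply: (norun trs).
Qed.

(** * Reduction of the four universality problems to bounded universality *)

Section Separated.
Variables (R : realType) (lam t : rat) (a : seq rat) (N : nat) (delta : rat).
Hypotheses (lam_gt0 : 0 < lam) (lam_lt1 : lam < 1).
Hypotheses (N_gt0 : (0 < N)%N) (delta_gt0 : 0 < delta).
Hypothesis sep : separates lam t a N delta.

(** Separation applies once [u] has length [N]; a shorter list is its own prefix. *)
Lemma separated_lt (u : seq rat) : {subset u <= a} ->
  (dsum lam (take N u) < t) = (dsum lam u < t).
Proof.
move=> ua; have d0 := delta_gt0; have [/(sep ua)[[]|[]] ? ?|/ltnW uN] := leqP N (size u).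
- by apply/idP/idP => ?; lra.
- by apply/idP/idP => ?; lra.
- by rewrite take_oversize.
Qed.

Lemma separated_le (u : seq rat) : {subset u <= a} ->
  (dsum lam (take N u) <= t) = (dsum lam u <= t).
Proof.
move=> ua; have d0 := delta_gt0; have [/(sep ua)[[]|[]] ? ?|/ltnW uN] := leqP N (size u).
- by apply/idP/idP => ?; lra.
- by apply/idP/idP => ?; lra.
- by rewrite take_oversize.
Qed.

Lemma fin_lt_universalP A : dsa_in_class a A ->
  bounded_universal N 0 true (fun u => dsum lam u < t) A <->
  fin_lt_universal R lam t A.
Proof.
move=> Aa; rewrite (bounded_universal_all _ Aa) //.
split=> univ w wA; have := univ w wA.
- move=> /(_ isT)[trs [runP accP]]; rewrite map_take separated_lt => [valP|].
    by apply/fin_A_ltP; exists trs; split=> //; exact: accP.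
  exact/(class_weights Aa)/fin_run_delta/runP.
- move=> /fin_A_ltP[trs [runP accP valP]] _; exists trs; split=> //.
  rewrite map_take separated_lt //.
  exact/(class_weights Aa)/fin_run_delta/runP.
Qed.

(** The weak and the strict tests can differ only on words shorter than [N], since longer sums never
    equal [t]. *)
Lemma fin_le_universalP A : dsa_in_class a A ->
  bounded_universal N 0 true (fun u => dsum lam u <= t) A <->
  fin_le_universal R lam t A.
Proof.
move=> Aa; rewrite (bounded_universal_all _ Aa) //.
split=> univ w wA; have := univ w wA.
- move=> /(_ isT)[trs [runP accP]]; rewrite map_take separated_le => [valP|].
    by apply/(fin_A_leP _ _ _ _ Aa); exists trs; split=> //; exact: accP.
  exact/(class_weights Aa)/fin_run_delta/runP.
- move=> /(fin_A_leP _ _ _ _ Aa)[trs [runP accP valP]] _; exists trs; split=> //.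
  rewrite map_take separated_le //.
  exact/(class_weights Aa)/fin_run_delta/runP.
Qed.

Lemma inf_run_fin A w trs n : inf_run A w trs ->
  fin_run A (mkseq w n) (mkseq trs n).
Proof.
move=> [initP runP]; split=> [|i]; rewrite !size_mkseq // => isz.
have [? ? _] := runP i; rewrite !nth_mkseq //; split=> //.
move: (i) isz => [//|j] jn /=; rewrite nth_mkseq ?(ltnW jn) //.
by have [_ _ <-] := runP j.
Qed.

Lemma fin_run_inf A w trs : (forall n, fin_run A (mkseq w n) (mkseq trs n)) ->
  inf_run A w trs.
Proof.
move=> runP; have stepP i : [/\ trs i \in dsa_delta A, tlet (trs i) = w i &
    tsrc (trs i) = fstate A (mkseq trs i.+1) i].
  have [_ /(_ i)] := runP i.+1; rewrite size_mkseq !nth_mkseq //; exact.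
split=> [|i]; first by have [] := stepP 0%N.
have [? ? _] := stepP i; split=> //.
by have [_ _ ->] := stepP i.+1; rewrite /= nth_mkseq.
Qed.

Lemma inf_run_weights A w trs : dsa_in_class a A -> inf_run A w trs ->
  forall i, twt (trs i) \in a.
Proof.
by move=> [_ _ /allP deltaP _] [_ runP] i; have [/deltaP/and4P[]] := runP i.
Qed.

Lemma inf_A_lt A w trs : dsa_in_class a A -> inf_run A w trs ->
  dsum lam (map twt (mkseq trs N)) < t -> (inf_A R lam A w < (ratr t : R)%:E)%E.
Proof.
move=> Aa runP lowP; apply/ereal_inf_ltP.
exists (inf_value R lam trs)%:E; first by exists trs.
have [[_ valP]|[+ _]] :=
    inf_value_separated lam_gt0 lam_lt1 R sep (inf_run_weights Aa runP).
  by rewrite lte_fin; apply: le_lt_trans valP _; rewrite ltr_rat gtrBl.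
by rewrite ltNge (ltW lowP).
Qed.

(** Without a low run every value is at least [t + delta], and so is the infimum, even over
    infinitely many runs. *)
Lemma inf_A_le A w : dsa_in_class a A -> (inf_A R lam A w <= (ratr t : R)%:E)%E ->
  exists2 trs, inf_run A w trs & dsum lam (map twt (mkseq trs N)) < t.
Proof.
have d0 := delta_gt0.
move=> Aa infP; apply: contrapT => norun.
suff : ((ratr (t + delta) : R)%:E <= inf_A R lam A w)%E.
  by move=> /le_trans/(_ infP); rewrite lee_fin ler_rat gerDl leNgt d0.
apply: le_ereal_inf_tmp => _ [trs runP <-]; rewrite lee_fin.
have [[lowP _]|[_ //]] :=
  inf_value_separated lam_gt0 lam_lt1 R sep (inf_run_weights Aa runP).
by case: norun; exists trs.
Qed.

(** Over infinite words one test serves both problems, as no run has value [t]. *)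
Definition low u := dsum lam u < t.

(** Koenig's lemma on the tree of finite runs on prefixes of [w], which branches over the finitely
    many transitions of [A]. *)
Lemma good_runs_inf_run A w :
  (forall n, (N <= n)%N -> exists trs, good_run N false low A (mkseq w n) trs) ->
  exists2 trs, inf_run A w trs & low (map twt (mkseq trs N)).
Proof.
move=> goodP.
(* Lowness is demanded only from length [N] on, which keeps [P] closed under prefixes. *)
pose P u := fin_run A (mkseq w (size u)) u /\
  ((N <= size u)%N -> low (map twt (take N u))).
have mkseq_take n m : (n <= m)%N -> take n (mkseq w m) = mkseq w n.
  by move=> nm; rewrite -map_take take_iota (minn_idPl nm).
have Ptake u n : P u -> P (take n u).
  have [nu|/ltnW nu] := leqP n (size u); last by rewrite take_oversize.
  move=> [runP lowP]; split.
    by rewrite size_takel // -(mkseq_take _ _ nu); exact: fin_run_take.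
  by rewrite size_takel // => Nn; rewrite take_takel //; apply: lowP; lia.
have [//||trs [_ trsP]] := @konig _ (dsa_delta A) P.
  (* Good runs are available only from length [N] on, so one of length [maxN N n], written
     [maxn N n], is taken and then cut to [n]. *)
  move=> n; have [|trs [runP _ lowP]] := goodP (maxn N n); first exact: leq_maxl.
  have szE : size trs = maxn N n by rewrite runP.1 size_mkseq.
  exists (take n trs); split.
  - by rewrite size_takel // szE leq_maxr.
  - by move=> x /mem_take; exact: fin_run_delta runP x.
  - by apply: Ptake; split; rewrite ?szE.
exists trs.
  by apply: fin_run_inf => n; have [] := trsP n; rewrite size_mkseq.
have [_] := trsP N; rewrite size_mkseq take_oversize ?size_mkseq //; exact.
Qed.

Lemma inf_universalP A : dsa_in_class a A ->
  bounded_universal N N false low A <->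
  forall w, inf_word A w -> exists2 trs, inf_run A w trs & low (map twt (mkseq trs N)).
Proof.
move=> Aa; rewrite (bounded_universal_all _ Aa) //.
split=> univ w wA => [|Nw].
  apply: good_runs_inf_run => n Nn; apply: univ; last by rewrite size_mkseq.
  by apply/allP => _ /mapP[i _ ->].
(* The finite word is prolonged by repeating its first letter, the default of [nth]; [w] is nonempty
   because [N] is positive, so this is a letter of [A]. *)
have [|trs runP lowP] := univ (nth (head 0%N w) w).
  move=> i; apply: (allP wA); have [iw|wi] := ltnP i (size w).
    exact: mem_nth.
  by rewrite nth_default // -nth0 mem_nth // (leq_trans N_gt0).
exists (mkseq trs (size w)); split=> //.
  by rewrite -{1}[w](mkseq_nth (head 0%N w)); exact: inf_run_fin.
by rewrite -map_take take_iota (minn_idPl Nw).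
Qed.

Lemma inf_lt_universalP A : dsa_in_class a A ->
  bounded_universal N N false low A <-> inf_lt_universal R lam t A.
Proof.
move=> Aa; rewrite (inf_universalP Aa); split=> univ w /univ.
  by move=> [trs runP lowP]; exact: inf_A_lt lowP.
by move=> /ltW/(inf_A_le Aa).
Qed.

Lemma inf_le_universalP A : dsa_in_class a A ->
  bounded_universal N N false low A <-> inf_le_universal R lam t A.
Proof.
move=> Aa; rewrite (inf_universalP Aa); split=> univ w /univ.
  by move=> [trs runP lowP]; apply/ltW; exact: inf_A_lt lowP.
by move=> /(inf_A_le Aa).
Qed.

End Separated.

Lemma decidable_over_equiv (X : countType) (C P Q : X -> Prop) :
  (forall x, C x -> P x <-> Q x) -> decidable_over C P -> decidable_over C Q.
Proof.
move=> PQ [p pP]; exists p => x Cx; have [b [evalP bP]] := pP x Cx.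
by exists b; split=> //; rewrite bP; exact: PQ.
Qed.

Theorem theorem30 (R : realType) (lam t : rat) (a : seq rat) :
  0 < lam -> lam < 1 ->
  ~ gtds_has_solution R lam t a ->
  [/\ decidable_over (dsa_in_class a) (fin_lt_universal R lam t),
      decidable_over (dsa_in_class a) (fin_le_universal R lam t),
      decidable_over (dsa_in_class a) (inf_lt_universal R lam t)
    & decidable_over (dsa_in_class a) (inf_le_universal R lam t)].
Proof.
move=> lam_gt0 lam_lt1 nosol.
have [N [delta [N_gt0 delta_gt0 sep]]] := unsolvable_separates lam_gt0 lam_lt1 nosol.
(* All four problems are instances of bounded universality, differing in the least length, the
   acceptance flag and the low predicate. *)
split; apply: decidable_over_equiv (decidable_bounded_universal _ _ _ _ _) => A Aa.
- exact: fin_lt_universalP delta_gt0 sep A Aa.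
- exact: fin_le_universalP delta_gt0 sep A Aa.
- exact: inf_lt_universalP lam_gt0 lam_lt1 N_gt0 delta_gt0 sep A Aa.
- exact: inf_le_universalP lam_gt0 lam_lt1 N_gt0 delta_gt0 sep A Aa.
Qed.
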